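(* Let $f:\mathbb{R}^n\to\mathbb{R}$ be differentiable and convex, let $m\ge 1$, $t_0\in\mathbb{R}$, and $\theta_c\in\mathbb{R}^n$. Let $a_0,\dots,a_{m-1}\in\mathbb{R}$ be constants such that the matrix $A$ (defined in the context) is Hurwitz, let $Q=Q^T>0$ be any symmetric positive definite $mn\times mn$ matrix, let $P=P^T>0$ be the solution of $A^TP+PA=-Q$, and put $C=B^TP$. Let $\alpha:[t_0,\infty)\to\mathbb{R}$ be continuous with $\alpha(t)\neq 0$ for all $t\ge t_0$. Let $\gamma:[t_0,\infty)\to\mathbb{R}$ be continuously differentiable with $\gamma(t)>0$ and $\dot\gamma(t)>0$ for all $t\ge t_0$. Let $\psi:\mathbb{R}^n\times[t_0,\infty)\to\mathbb{R}$ be continuously differentiable, and suppose that for some constant $\underline{\psi}$ one has $\psi(v,t)\ge\underline{\psi}$ and $\frac{\partial}{\partial t}\psi(v,t)\le 0$ for all $v$ and all $t\ge t_0$. Define $$U(v,t)=\gamma(t)\left[f\left(\gamma(t)^{-1}v+\theta_c\right)-f(\theta_c)\right]+\psi(v,t).$$ Let $(x(t),v(t))\in\mathbb{R}^{mn}\times\mathbb{R}^n$, $t\ge t_0$, be a solution of $$\dot x(t)=Ax(t)+Bu(t),\qquad u(t)=-\alpha(t)\nabla_vU(v(t),t),\qquad y(t)=Cx(t),\qquad \dot v(t)=\alpha(t)y(t),$$ and set $\theta(t)=\gamma(t)^{-1}v(t)+\theta_c$ and $V(t)=\frac12x(t)^TPx(t)$. Assume $\theta_c$ is such that $f(\theta(t))-f(\theta_c)\ge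 0$ for all $t\ge t_0$ (for example, $\theta_c$ is a minimiser of $f$), and that $U(v(t),t)\ge 0$ for all $t\ge t_0$. Let $E=U(v(t_0),t_0)+V(t_0)$. Then for all $t\ge t_0$: (i) (conservation relation) $$E=\gamma(t)\left[f(\theta(t))-f(\theta_c)\right]+\psi(v(t),t)+V(t)+\int_{t_0}^t\dot\gamma(\tau)D_f(\theta_c,\theta(\tau))\,d\tau-\int_{t_0}^t\frac{\partial\psi}{\partial\tau}(v(\tau),\tau)\,d\tau+\frac12\int_{t_0}^tx(\tau)^TQx(\tau)\,d\tau;$$ (ii) (convergence rate bound) $$f(\theta(t))-f(\theta_c)\le\frac{E-\underline{\psi}}{\gamma(t)}=\frac{\gamma(t_0)\left[f(\theta(t_0))-f(\theta_c)\right]+\psi(v(t_0),t_0)-\underline{\psi}+\frac12x(t_0)^TPx(t_0)}{\gamma(t)};$$ (iii) $\psi(v(t),t)\le E$.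
   Context: The matrices $A\in\mathbb{R}^{mn\times mn}$ and $B\in\mathbb{R}^{mn\times n}$ are the controllable canonical form $$A=\begin{bmatrix}0&1&0&\cdots&0\\0&0&1&\cdots&0\\\vdots&\vdots&\vdots&\ddots&\vdots\\0&0&0&\cdots&1\\-a_0&-a_1&-a_2&\cdots&-a_{m-1}\end{bmatrix}\otimes I_n,\qquad B=\begin{bmatrix}0\\0\\\vdots\\0\\1\end{bmatrix}\otimes I_n,$$ where $\otimes$ is the Kronecker product (for $m=1$: $A=-a_0I_n$, $B=I_n$). Equivalently, $x=(w,\dot w,\dots,w^{(m-1)})$ with $w(t)\in\mathbb{R}^n$ satisfying $w^{(m)}+a_{m-1}w^{(m-1)}+\cdots+a_1\dot w+a_0w=-\alpha(t)\nabla_vU(v(t),t)$. A matrix is Hurwitz if all its eigenvalues have negative real part; in that case the Lyapunov equation $A^TP+PA=-Q$ with $Q=Q^T>0$ has a unique solution $P$, and it is symmetric positive definite. The Bregman divergence is $D_f(p,q)=f(p)-f(q)-\langle\nabla f(q),p-q\rangle$. The partial derivative $\frac{\partial}{\partial t}\psi(v,t)$ is taken with $v$ held fixed. *)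

(* Defs.v *)
From mathcomp Require Import all_boot all_order all_algebra.
From mathcomp Require Import all_classical all_reals all_analysis.
From mathcomp.real_closed Require Import complex mxtens.

Set Implicit Arguments.
Unset Strict Implicit.
Unset Printing Implicit Defensive.

Import Order.TTheory GRing.Theory Num.Theory.
Import numFieldNormedType.Exports.

Local Open Scope classical_set_scope.
Local Open Scope ring_scope.

Section Matrices.
Variable R : realType.

Definition companion (m : nat) (a : 'I_m -> R) : 'M[R]_m :=
  \matrix_(i < m, j < m)
    (if i.+1 == m :> nat then - a j else (i.+1 == j :> nat)%:R).

Definition last_basis (m : nat) : 'cV[R]_m :=
  \col_(i < m) (i.+1 == m :> nat)%:R.

Definition canonA (m n : nat) (a : 'I_m -> R) : 'M[R]_(m * n) :=
  tensmx (companion a) (1%:M : 'M[R]_n).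

(* The cast only turns the width 1 * n of the Kronecker product into n. *)
Definition canonB (m n : nat) : 'M[R]_(m * n, n) :=
  castmx (erefl, mul1n n) (tensmx (last_basis m) (1%:M : 'M[R]_n)).

Definition hurwitz (d : nat) (M : 'M[R]_d) : Prop :=
  forall z : R[i],
    eigenvalue (map_mx (real_complex R) M) z -> complex.Re z < 0.

Definition qform (d : nat) (M : 'M[R]_d) (x : 'cV[R]_d) : R :=
  (x^T *m M *m x) 0 0.

Definition sym_posdef (d : nat) (M : 'M[R]_d) : Prop :=
  M^T = M /\ forall x : 'cV[R]_d, x != 0 -> 0 < qform M x.

Definition dot (d : nat) (p q : 'cV[R]_d) : R := (p^T *m q) 0 0.

End Matrices.

Section DerivativeWithin.
Variables (R : realType) (W : normedModType R).
Implicit Types (D : set R) (g : R -> W) (t : R).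

(* For D = [t0, +oo[ the following derivatives are the usual ones at every
   t > t0 and the right derivative at t0; they never look at the values of g
   outside D. *)
Definition diff_quot g t : R -> W := fun s => (s - t)^-1 *: (g s - g t).

Definition is_derive_within D g t (l : W) : Prop :=
  diff_quot g t s @[s --> within D t^'] --> l.

Definition derivable_within D g t : Prop :=
  cvg (diff_quot g t s @[s --> within D t^']).

Definition derive_within D g t : W :=
  lim (diff_quot g t s @[s --> within D t^']).

Definition C1_within D g : Prop :=
  (forall t, D t -> derivable_within D g t) /\
  {within D, continuous (derive_within D g)}.

End DerivativeWithin.

Section Gradient.
Variables (R : realType) (n : nat).
Implicit Types (f : 'cV[R]_n -> R) (psi : 'cV[R]_n -> R -> R).

Definition gradient f (x : 'cV[R]_n) : 'cV[R]_n :=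
  \col_(i < n) 'D_(delta_mx i 0) f x.

Definition bregman f (p q : 'cV[R]_n) : R :=
  f p - f q - dot (gradient f q) (p - q).

(* Continuous differentiability on R^n x D: the partial derivatives in the
   vector and in the scalar variable exist and are jointly continuous; the
   scalar one is taken within D, hence one-sided at an end point of D. *)
Definition C1_prod_within (D : set R) psi : Prop :=
  [/\ forall v t, D t -> differentiable (fun w => psi w t) v,
      forall v t, D t -> derivable_within D (psi v) t,
      {within [set p : 'cV[R]_n * R | D p.2],
        continuous (fun p => gradient (fun w => psi w p.2) p.1)} &
      {within [set p : 'cV[R]_n * R | D p.2],
        continuous (fun p => derive_within D (psi p.1) p.2)}].

End Gradient.

(* Main.v *)
Require Import Defs.
From mathcomp Require Import all_boot all_order all_algebra.
From mathcomp Require Import all_classical all_reals all_analysis.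
From mathcomp Require Import ring lra.

Set Implicit Arguments.
Unset Strict Implicit.
Unset Printing Implicit Defensive.

Import Order.TTheory GRing.Theory Num.Theory.
Import numFieldNormedType.Exports.

Local Open Scope classical_set_scope.
Local Open Scope ring_scope.

(** The total energy U(v(t),t) + V(t) is differentiable along the flow.  In
    V' = - 1/2 x^T Q x + <y, u> and U' = alpha <grad U, y> - gamma' D_f + d_t psi
    the cross terms cancel, because u = - alpha grad U and B^T P x = y; this is
    the storage-function identity of a passive interconnection.  Integrating
    gives (i), and (ii), (iii) follow by dropping nonnegative terms.
    The fundamental theorem of calculus needs a continuous integrand, whereas f
    is only assumed differentiable: convexity makes its gradient continuous,
    since 'd f y h is at most (f (y + k h) - f y) / k for k > 0, which is
    continuous in y. *)

(** * Algebra of the dot product *)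

Section Dot.
Variables (R : realType) (d : nat).
Implicit Types p q : 'cV[R]_d.

Lemma dotC p q : dot p q = dot q p.
Proof. by rewrite /dot !mxE; apply: eq_bigr => i _; rewrite !mxE mulrC. Qed.

Lemma dotZr k p q : dot p (k *: q) = k * dot p q.
Proof. by rewrite /dot -scalemxAr mxE. Qed.

Lemma dotNr p q : dot p (- q) = - dot p q.
Proof. by rewrite /dot mulmxN mxE. Qed.

End Dot.

(** * One-sided derivatives: continuity, comparison with ordinary derivatives, chain rule *)

Section DeriveWithin.
Variables (R : realType) (D : set R).
Implicit Types (W : normedModType R) (t : R).

Lemma cvg_within_dnbhs W (g : R -> W) t :
  g @ within D t^' --> g t -> g @ within D (nbhs t) --> g t.
Proof.
move=> /cvgrPdist_lt gt; apply/cvgrPdist_lt => e e0.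
move: (gt e e0); rewrite !near_withinE => gt'.
suff : nbhs t (fun s => s != t -> D s -> `|g t - g s| < e).
  apply: filterS => s + Ds; have [->|st] := eqVneq s t; last exact.
  by rewrite subrr normr0.
exact: gt'.
Qed.

(** Near [t], [g s] equals [g t] plus the vanishing factor [s - t] times a difference quotient that
    converges. *)
Lemma cvg_is_derive_within W (g : R -> W) t l :
  is_derive_within D g t l -> g @ within D (nbhs t) --> g t.
Proof.
move=> gl; apply: cvg_within_dnbhs.
have st : (fun s => s - t) @ within D t^' --> (0 : R).
  apply: (cvg_trans (cvg_app _ (cvg_within _))).
  rewrite -(subrr t); apply: cvgB; last exact: cvg_cst.
  exact: (cvg_within).
have : (fun s => g t + (s - t) *: diff_quot g t s) @ within D t^' -->
    g t + 0 *: l.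
  by apply: cvgD; [exact: cvg_cst|exact: cvgZ].
rewrite scale0r addr0; apply: cvg_trans; apply: near_eq_cvg.
rewrite near_withinE; near=> s => Ds.
have st0 : s - t != 0 by rewrite subr_eq0; near: s; exact: nbhs_dnbhs_neq.
by rewrite /diff_quot scalerA divff// scale1r addrC subrK.
Unshelve. all: by end_near. Qed.

(** At an interior point the restriction to [D] is automatic, so translating by [t] turns one
    difference quotient into the other. This gives access to the classical mean value theorem and
    fundamental theorem of calculus. *)
Lemma is_derive_within_interior W (g : R -> W) t l : D° t ->
  is_derive_within D g t l -> is_derive t 1 g l.
Proof.
move=> Dt gl.
have sh : (fun h => h + t) @ (0 : R)^' --> within D t^'.
  move=> P; rewrite /within/= => tP.
  have : nbhs t (fun s => s != t -> P s).
    have : nbhs t (fun s => s != t -> D s -> P s) by exact: tP.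
    by apply: filterS2 Dt => s Ds + st; apply.
  rewrite -[nbhs t _]/(\forall s \near t, s != t -> P s) (near_shift 0 t) subr0.
  apply: filterS => h /= Ph h0; apply: Ph.
  by rewrite -subr_eq0 addrK.
have q : (fun h => h^-1 *: ((g \o shift t) (h *: (1 : R)) - g t)) @ 0^' --> l.
  have := cvg_comp _ _ sh gl; apply: cvg_trans; apply: near_eq_cvg.
  by near=> h; rewrite /diff_quot/= addrK [h *: _]mulr1.
by apply: DeriveDef; [apply/cvg_ex; exists l|exact: cvg_lim].
Unshelve. all: by end_near. Qed.

(** The first-order expansion of [F] at [g t] is applied to the increment [g s - g t]. After
    division by [s - t], the remainder is at most a small constant times the norm of
    [diff_quot g t s], which stays bounded. *)
Lemma is_derive_within_comp (V W : normedModType R) (F : V -> W) (g : R -> V) t l :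
  differentiable F (g t) -> is_derive_within D g t l ->
  is_derive_within D (F \o g) t ('d F (g t) l).
Proof.
move=> dF gl.
have gt := cvg_is_derive_within gl.
have [dFc _] := (diff_locallyxP _ _).1 dF.
have c1 : (fun s => 'd F (g t) (diff_quot g t s)) @ within D t^' --> 'd F (g t) l.
  exact: (cvg_comp _ _ gl (dFc l)).
rewrite /is_derive_within -[X in _ --> X]add0r.
suff c2 : (fun s => diff_quot (F \o g) t s - 'd F (g t) (diff_quot g t s))
    @ within D t^' --> (0 : W).
  apply: cvg_trans (cvgD c2 c1); apply: near_eq_cvg; near=> s.
  by rewrite /= subrK.
apply/cvgrPdist_le => e e0.
(* Adding 1 gives a bound that the norms of the quotients eventually respect, and a positive divisor
   even when [l = 0]. *)
have k0 : 0 < `|l| + 1 by rewrite ltr_pwDr.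
have ek0 : 0 < e / (`|l| + 1) by rewrite divr_gt0.
have : \forall h \near (0 : V),
    `|F (h + g t) - F (g t) - 'd F (g t) h| <= e / (`|l| + 1) * `|h|.
  have /eqaddoP := diff_locally dF.
  move=> /(_ _ ek0); apply: filterS => h /=.
  by rewrite -[in X in X -> _]fctE/= opprD addrA.
rewrite -(subrr (g t)) => o1.
have gst : (fun s => g s - g t) @ within D t^' --> g t - g t.
  apply: cvgB; last exact: cvg_cst.
  apply: cvg_trans gt; apply: cvg_app => P; rewrite /within/=.
  exact: nbhs_dnbhs.
have o2 := gst _ o1.
have lb : \forall s \near within D t^', `|diff_quot g t s| <= `|l| + 1.
  by apply: (cvgr_norm_le _ gl); rewrite ltrDl.
near=> s.
rewrite sub0r normrN.
have -> : diff_quot (F \o g) t s - 'd F (g t) (diff_quot g t s) =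
    (s - t)^-1 *: (F (g s - g t + g t) - F (g t) - 'd F (g t) (g s - g t)).
  by rewrite /diff_quot linearZ subrK [RHS]scalerBr.
rewrite normrZ.
apply: (@le_trans _ _ (`|(s - t)^-1| * (e / (`|l| + 1) * `|g s - g t|))).
  by apply: ler_wpM2l => //; near: s; exact: o2.
rewrite mulrCA -normrZ -/(diff_quot g t s).
rewrite -[leRHS](divfK (lt0r_neq0 k0)).
by apply: ler_wpM2l; [exact: ltW|near: s].
Unshelve. all: by end_near. Qed.

End DeriveWithin.

(** * Sum, product and quadratic-form rules for one-sided derivatives *)

Section DeriveWithinRules.
Variables (R : realType) (D : set R).

Lemma is_derive_withinD (W : normedModType R) (g h : R -> W) t k l :
  is_derive_within D g t k -> is_derive_within D h t l ->
  is_derive_within D (fun s => g s + h s) t (k + l).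
Proof.
move=> gk hl; rewrite /is_derive_within.
have -> : diff_quot (fun s => g s + h s) t = diff_quot g t \+ diff_quot h t.
  by apply/funext => s; rewrite /diff_quot /= -scalerDr opprD addrACA.
exact: cvgD.
Qed.

Lemma is_derive_within_cst (W : normedModType R) (w : W) t :
  is_derive_within D (fun=> w) t 0.
Proof.
rewrite /is_derive_within (_ : diff_quot _ _ = cst 0); first exact: cvg_cst.
by apply/funext => s; rewrite /diff_quot subrr scaler0.
Qed.

Lemma cvg_is_derive_within_dnbhs (W : normedModType R) (g : R -> W) t l :
  is_derive_within D g t l -> g @ within D t^' --> g t.
Proof.
move=> /cvg_is_derive_within; apply: cvg_trans; apply: cvg_app => P.
exact: nbhs_dnbhs.
Qed.

Lemma is_derive_withinZ (W : normedModType R) (c : R -> R) (g : R -> W) t k l :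
  is_derive_within D c t k -> is_derive_within D g t l ->
  is_derive_within D (fun s => c s *: g s) t (k *: g t + c t *: l).
Proof.
move=> ck gl; have gt := cvg_is_derive_within_dnbhs gl.
rewrite /is_derive_within.
(* Telescoping through [c t *: g s]; the first summand then converges because [g] is continuous at
   [t]. *)
have -> : diff_quot (fun s => c s *: g s) t =
   (fun s => diff_quot c t s *: g s) \+ (fun s => c t *: diff_quot g t s).
  apply/funext => s; rewrite /diff_quot /=.
  rewrite -[(s - t)^-1 *: (c s - c t)]/((s - t)^-1 * (c s - c t)) -scalerA.
  rewrite [c t *: (_ *: _)]scalerA [c t * _]mulrC -scalerA -scalerDr.
  by congr (_ *: _); rewrite scalerBr scalerBl addrA subrK.
by apply: cvgD; [exact: cvgZ|exact: cvgZl_tmp].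
Qed.

(** The form is a finite sum of products of entries. Hypotheses are entrywise so that the result
    also applies to a gradient, whose convergence is obtained one partial derivative at a time. *)
Lemma cvg_bilinear_form (T : Type) (F : set_system T) {FF : Filter F} (d e : nat)
    (M : 'M[R]_(d, e)) (p : T -> 'cV[R]_d) (q : T -> 'cV[R]_e)
    (p0 : 'cV[R]_d) (q0 : 'cV[R]_e) :
  (forall i, p s i 0 @[s --> F] --> p0 i 0) ->
  (forall i, q s i 0 @[s --> F] --> q0 i 0) ->
  ((p s)^T *m M *m q s) 0 0 @[s --> F] --> (p0^T *m M *m q0) 0 0.
Proof.
move=> pp qq; rewrite mxE; under eq_fun do rewrite mxE.
apply: cvg_big => [|j _]; first exact: add_continuous.
apply: cvgM; last exact: qq.
rewrite mxE; under eq_fun do rewrite mxE.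
apply: cvg_big => [|i _]; first exact: add_continuous.
apply: cvgM; last exact: cvg_cst.
by rewrite mxE; under eq_fun do rewrite mxE; exact: pp.
Qed.

Lemma cvg_coord (T : Type) (F : set_system T) {FF : Filter F} (d : nat)
    (p : T -> 'cV[R]_d) (p0 : 'cV[R]_d) i :
  p @ F --> p0 -> p s i 0 @[s --> F] --> p0 i 0.
Proof. by move=> pp; exact: cvg_comp _ _ pp (@coord_continuous R d 1 i 0 p0). Qed.

Lemma is_derive_within_qform (d : nat) (M : 'M[R]_d) (x : R -> 'cV[R]_d) t l :
  is_derive_within D x t l ->
  is_derive_within D (fun s => qform M (x s)) t
    ((l^T *m M *m x t) 0 0 + ((x t)^T *m M *m l) 0 0).
Proof.
move=> xl; have xt := cvg_is_derive_within_dnbhs xl.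
rewrite /is_derive_within.
(* Telescoping through the mixed term [(x t)^T *m M *m x s]. *)
have -> : diff_quot (fun s => qform M (x s)) t =
   (fun s => ((diff_quot x t s)^T *m M *m x s) 0 0) \+
   (fun s => ((x t)^T *m M *m diff_quot x t s) 0 0).
  apply/funext => s.
  rewrite /diff_quot /= /qform linearZ/= -!scalemxAl -scalemxAr.
  have -> : (x s - x t)^T = (x s)^T - (x t)^T by exact: linearB.
  have ZE (k : R) (N : 'M[R]_1) : (k *: N) 0 0 = k * N 0 0 by rewrite mxE.
  have BE (N N' : 'M[R]_1) : (N - N') 0 0 = N 0 0 - N' 0 0 by rewrite !mxE.
  by rewrite !mulmxBl mulmxBr !ZE !BE -mulrDr addrA subrK.
apply: cvgD; apply: cvg_bilinear_form => i.
- exact: (cvg_coord xl).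
- exact: (cvg_coord xt).
- exact: cvg_cst.
- exact: (cvg_coord xl).
Qed.

End DeriveWithinRules.

(** * The gradient represents the differential *)

Section Gradient.
Variables (R : realType) (n : nat) (f : 'cV[R]_n -> R).

Lemma dot_gradient z h : differentiable f z -> dot (gradient f z) h = 'd f z h.
Proof.
move=> df; rewrite /dot mxE.
have {2}-> : h = \sum_i h i 0 *: delta_mx i 0.
  apply/colP => i; rewrite summxE (bigD1 i)//= big1 ?addr0.
    by rewrite !mxE !eqxx mulr1.
  by move=> j ji; rewrite !mxE eq_sym (negbTE ji) mulr0.
rewrite linear_sum/=; apply: eq_bigr => i _.
by rewrite linearZ/= !mxE deriveE// mulrC.
Qed.

End Gradient.

(** * Calculus on a closed half-line and the total time derivative of [psi] *)

Section HalfLine.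
Variables (R : realType) (t0 : R).
Local Notation D := (`[t0, +oo[%classic).

Lemma interior_half_line t : t0 < t -> D° t.
Proof.
move=> t0t; have := near_in_itvoy (_ : t \in `]t0, +oo[).
rewrite in_itv/= t0t => /(_ isT); apply: filterS => s.
by rewrite /= !in_itv/= !andbT => /ltW.
Qed.

Lemma continuous_segment_half_line (W : topologicalType) (g : R -> W) a b :
  t0 <= a -> {within D, continuous g} -> {within `[a, b], continuous g}.
Proof.
move=> t0a; apply: continuous_subspaceW => s /=.
by rewrite !in_itv/= andbT => /andP[as' _]; exact: le_trans as'.
Qed.

(** Strictly between [a] and [b] the derivative is an ordinary one; at the end points only
    continuity is used, so [a = t0] is allowed. *)
Lemma mean_value_within (g dg : R -> R) a b : t0 <= a -> a <= b ->
  (forall t, D t -> is_derive_within D g t (dg t)) ->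
  exists2 c, c \in `[a, b] & g b - g a = dg c * (b - a).
Proof.
move=> t0a ab dgD; apply: MVT_segment => //.
  move=> s; rewrite in_itv/= => /andP[as' _].
  have t0s : t0 < s by exact: le_lt_trans as'.
  apply: is_derive_within_interior (dgD s _); first exact: interior_half_line.
  by rewrite /= in_itv/= andbT ltW.
apply: continuous_segment_half_line t0a _.
by apply/subspace_continuousP => s Ds; exact: cvg_is_derive_within (dgD s Ds).
Qed.

Lemma Rintegral_derive_within (g dg : R -> R) t : t0 <= t ->
  (forall s, D s -> is_derive_within D g s (dg s)) ->
  {within D, continuous dg} ->
  \int[lebesgue_measure]_(s in `[t0, t]) dg s = g t - g t0.
Proof.
move=> t0t dgD dgc; move: (t0t); rewrite le_eqVlt => /predU1P[<-|{}t0t].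
  by rewrite set_itv1 Rintegral_set1 subrr.
have gc : {within `[t0, t], continuous g}.
  apply: continuous_segment_half_line (lexx _) _.
  by apply/subspace_continuousP => s Ds; exact: cvg_is_derive_within (dgD s Ds).
have [gco gt0 gt] := (continuous_within_itvP _ t0t).1 gc.
have gi s : s \in `]t0, t[ -> is_derive s 1 g (dg s).
  rewrite in_itv/= => /andP[t0s _].
  apply: is_derive_within_interior (dgD s _); first exact: interior_half_line.
  by rewrite /= in_itv/= andbT ltW.
rewrite /Rintegral (@continuous_FTC2 _ dg g _ _ t0t
  (continuous_segment_half_line (lexx _) dgc))//.
- by split=> // s /gi [].
- by move=> s /gi gs; rewrite derive1E derive_val.
Qed.

(** The increment is split at [psi (v s) t]. The change in the vector at frozen time [t] is handled
    by the chain rule; the change in time at frozen vector [v s] by joint continuity of the time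
    derivative at [(v t, t)]. *)
Lemma is_derive_within_C1_prod (n : nat) (psi : 'cV[R]_n -> R -> R) v t l :
  C1_prod_within D psi -> t0 <= t -> is_derive_within D v t l ->
  is_derive_within D (fun s => psi (v s) s) t
    ('d (psi^~ t) (v t) l + derive_within D (psi (v t)) t).
Proof.
move=> [psid psit _ /subspace_continuousP psic] t0t vl.
have Dt : D t by rewrite /= in_itv/= andbT.
have c1 := is_derive_within_comp (psid (v t) t Dt) vl.
rewrite /is_derive_within.
have -> : diff_quot (fun s => psi (v s) s) t = diff_quot (psi^~ t \o v) t \+
   (fun s => (s - t)^-1 *: (psi (v s) s - psi (v s) t)).
  apply/funext => s; rewrite /diff_quot /= -scalerDr; congr (_ *: _).
  by rewrite [in RHS]addrC addrA subrK.
apply: cvgD => //.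
apply/cvgrPdist_lt => e e0.
have := psic (v t, t) Dt => /cvgrPdist_lt /(_ e e0).
rewrite near_withinE => -[[/= A B] [Av Bt] AB].
have Av' := cvg_is_derive_within_dnbhs vl Av.
have neqt : \forall s \near within D t^', s != t.
  exact: cvg_within (nbhs_dnbhs_neq t).
(* A ball around [t] contains every point between [s] and [t], so the intermediate point found below
   remains in [B]. *)
have [/= r r0 rB] := (nbhs_ballP _ _).1 Bt.
have ballt : \forall s \near within D t^', ball t r s.
  by apply: cvg_within; apply: nbhs_dnbhs; exact: nbhsx_ballx.
near=> s.
have Ds : D s by near: s; exact: withinT.
have st : s != t.
  by near: s; exact: neqt.
have As : A (v s) by near: s; exact: Av'.
have sr : ball t r s.
  by near: s; exact: ballt.
have t0s : t0 <= s by move: Ds; rewrite /= in_itv/= andbT.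
have pd := psit (v s).
(* Mean value theorem in the time variable, at the moving point v s. *)
suff [c cr ->] : exists2 c, B c /\ D c &
    psi (v s) s - psi (v s) t = derive_within D (psi (v s)) c * (s - t).
  rewrite [_ *: _]mulrC mulfK ?subr_eq0//.
  by case: cr => Bc Dc; exact: (AB (v s, c)).
have [st'|ts] := leP s t.
  have [c] := mean_value_within t0s st' pd.
  rewrite in_itv/= => /andP[sc ct] E; exists c; last first.
    by rewrite -opprB E -mulrN opprB.
  split; last by rewrite /= in_itv/= andbT (le_trans t0s).
  apply: rB; move: sr; rewrite /ball/= !ger0_norm ?subr_ge0//.
  by apply: le_lt_trans; lra.
have [c] := mean_value_within t0t (ltW ts) pd.
rewrite in_itv/= => /andP[tc cs] E; exists c => //.
split; last by rewrite /= in_itv/= andbT (le_trans t0t).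
apply: rB; move: sr.
rewrite /ball/= ![`|t - _|]distrC !ger0_norm ?subr_ge0 ?(ltW ts)//.
by apply: le_lt_trans; lra.
Unshelve. all: by end_near. Qed.

End HalfLine.

(** * Differentials of convex functions: supporting hyperplane and continuity *)

Section ConvexGradient.
Variables (R : realType) (V : normedModType R) (f : V -> R).
Hypothesis fdiff : forall z, differentiable f z.
Hypothesis fconv : convex_function (E := V) setT f.

(** For [0 < k <= 1], convexity between [z] and [z + h] bounds the difference quotient of step [k]
    by [f (z + h) - f z]; the bound passes to the limit as [k] tends to 0 from the right. *)
Lemma convex_diff_le z h : 'd f z h <= f (z + h) - f z.
Proof.
have dh : k^-1 *: ((f \o shift z) (k *: h) - f z) @[k --> 0^'] --> 'd f z h.
  by rewrite -deriveE//; exact: diff_derivable.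
apply: (cvgr_to_le (cvg_dnbhs_at_right dh)).
near=> k.
have k0 : 0 < k by near: k; exact: nbhs_right_gt.
have k1 : k <= 1 by near: k; exact: nbhs_right_le.
rewrite /= [_ *: (_ - _)]mulrC ler_pdivrMr//.
have := fconv (Itv01 (ltW k0) k1) (in_setT (z + h : convex_lmodType _))
  (in_setT (z : convex_lmodType _)).
rewrite convRE /=.
have -> : conv (Itv01 (ltW k0) k1) (z + h : convex_lmodType _)
    (z : convex_lmodType _) = k *: h + z.
  rewrite /conv/= /unstable.onem.
  by rewrite scalerDr scalerBl scale1r addrAC addrC subrKC.
by rewrite /unstable.onem; lra.
Unshelve. all: by end_near. Qed.

(** A step [k] is fixed first so that the quotient at [z] is below ['d f z h + e]. By continuity of
    [f] this persists for [y] near [z], and the supporting hyperplane at [y] puts ['d f y h] below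
    the quotient. *)
Lemma convex_diff_usc z h e : 0 < e ->
  \forall y \near z, 'd f y h < 'd f z h + e.
Proof.
move=> e0.
have dh : k^-1 *: ((f \o shift z) (k *: h) - f z) @[k --> 0^'] --> 'd f z h.
  by rewrite -deriveE//; exact: diff_derivable.
have [k [k0 kq]] : exists k,
    0 < k /\ k^-1 * (f (z + k *: h) - f z) < 'd f z h + e.
  near (0 : R)^'+ => k; exists k; split; first by near: k; exact: nbhs_right_gt.
  rewrite [z + _]addrC; near: k.
  by apply: (cvgr_lt _ (cvg_dnbhs_at_right dh)); rewrite ltrDl.
have fc : continuous f by move=> y; exact: differentiable_continuous.
have qc : (fun y => k^-1 * (f (y + k *: h) - f y)) @ z -->
    k^-1 * (f (z + k *: h) - f z).
  apply: cvgZl_tmp.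
  apply: cvgB; last exact: fc.
  have sc : (fun y => y + k *: h) @ z --> z + k *: h.
    by apply: cvgD; [exact: cvg_id|exact: cvg_cst].
  exact: cvg_comp _ _ sc (fc _).
have qlt := cvgr_lt _ qc _ kq.
near=> y.
have : k^-1 * (f (y + k *: h) - f y) < 'd f z h + e by near: y; exact: qlt.
apply: le_lt_trans.
rewrite ler_pdivlMl//.
by have := convex_diff_le y (k *: h); rewrite linearZ.
Unshelve. all: by end_near. Qed.

Lemma continuous_convex_diff z h : (fun y => 'd f y h) @ z --> 'd f z h.
Proof.
apply/cvgrPdist_lt => e e0; near=> y.
rewrite distrC ltr_distl ltrBlDr; apply/andP; split; last first.
  by near: y; exact: convex_diff_usc.
(* Linearity in [h] turns upper semicontinuity in direction [- h] into the missing lower bound. *)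
have : 'd f y (- h) < 'd f z (- h) + e.
  by near: y; exact: convex_diff_usc.
by rewrite !linearN/=; lra.
Unshelve. all: by end_near. Qed.

End ConvexGradient.

Lemma bregman_ge0 (R : realType) (n : nat) (f : 'cV[R]_n -> R) p q :
  (forall z, differentiable f z) -> convex_function setT f -> 0 <= bregman f p q.
Proof.
move=> fdiff fconv.
rewrite /bregman dot_gradient// subr_ge0.
by apply: le_trans (convex_diff_le fdiff fconv q (p - q)) _; rewrite subrKC.
Qed.


(** * Derivatives of the time-dependent potential [U] *)

Section Potential.
Variables (R : realType) (n : nat) (f : 'cV[R]_n -> R) (psi : 'cV[R]_n -> R -> R).
Variables (gamma : R -> R) (t0 : R) (thetac : 'cV[R]_n).
Local Notation D := (`[t0, +oo[%classic).
Local Notation dgamma := (derive_within D gamma).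
Local Notation dpsi := (fun w t => derive_within D (psi w) t).
Hypothesis fdiff : forall z, differentiable f z.
Hypothesis gammaD : forall t, D t -> derivable_within D gamma t.
Hypothesis gamma_gt0 : forall t, t0 <= t -> 0 < gamma t.
Hypothesis psiC1 : C1_prod_within D psi.

Let U (w : 'cV[R]_n) (t : R) : R :=
  gamma t * (f ((gamma t)^-1 *: w + thetac) - f thetac) + psi w t.

(** The prefactor [gamma t] cancels the [(gamma t)^-1] produced by the inner affine map. *)
Lemma is_diff_potential t w : t0 <= t ->
  is_diff w (U^~ t)
    (fun h => 'd f ((gamma t)^-1 *: w + thetac) h + 'd (psi^~ t) w h).
Proof.
move=> t0t; have Dt : D t by rewrite /= in_itv/= andbT.
have [/(_ w t Dt) psid _ _ _] := psiC1.
have gt0 : gamma t != 0 by rewrite gt_eqF// gamma_gt0.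
set th := (gamma t)^-1 *: w + thetac.
have dth : is_diff w (fun w => (gamma t)^-1 *: w + thetac)
    (fun h => (gamma t)^-1 *: h).
  by apply: is_diff_eq; rewrite addr0.
have dfth : is_diff th f ('d f th) by exact: differentiableP.
have dpsit : is_diff w (psi^~ t) ('d (psi^~ t) w) by exact: differentiableP.
have dfth' := is_diff_comp dth dfth.
have -> : U^~ t = (gamma t *: ((f \o (fun w => (gamma t)^-1 *: w + thetac)) -
    cst (f thetac))) + psi^~ t.
  by apply/funext.
apply: is_diff_eq.
apply/funext => h /=.
have dZ : 'd f th ((gamma t)^-1 *: h) = (gamma t)^-1 * 'd f th h by exact: linearZ.
rewrite -[LHS]/(gamma t * ('d f th ((gamma t)^-1 *: h) - 0) + 'd (psi^~ t) w h).
congr (_ + _).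
rewrite dZ subr0; exact: mulVKf.
Qed.

Lemma is_derive_within_theta (v : R -> 'cV[R]_n) t l : t0 <= t ->
  is_derive_within D v t l ->
  is_derive_within D (fun s => (gamma s)^-1 *: v s + thetac) t
    (- (gamma t) ^- 2 * dgamma t *: v t + (gamma t)^-1 *: l).
Proof.
move=> t0t vl; have Dt : D t by rewrite /= in_itv/= andbT.
have gt0 : gamma t != 0 by rewrite gt_eqF// gamma_gt0.
have := is_derive_within_comp (differentiable_Rinv gt0) (gammaD Dt).
rewrite diff_Rinv// => ginv.
have := is_derive_withinD (is_derive_withinZ ginv vl)
  (is_derive_within_cst D thetac t).
by rewrite addr0.
Qed.

(** Writing theta for the argument of [f], [thetac] - theta is [- (gamma t)^-1 *: v t]. Hence the
    variation of [gamma], both as prefactor and inside theta, adds up to exactly [- dgamma t] times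
    the Bregman divergence. *)
Lemma is_derive_within_potential (v : R -> 'cV[R]_n) t l : t0 <= t ->
  is_derive_within D v t l ->
  is_derive_within D (fun s => U (v s) s) t
    (dot (gradient (U^~ t) (v t)) l
     - dgamma t * bregman f thetac ((gamma t)^-1 *: v t + thetac)
     + dpsi (v t) t).
Proof.
move=> t0t vl; have Dt : D t by rewrite /= in_itv/= andbT.
have gt0 : gamma t != 0 by rewrite gt_eqF// gamma_gt0.
have dU := is_diff_potential (v t) t0t.
have dUl : dot (gradient (U^~ t) (v t)) l =
    'd f ((gamma t)^-1 *: v t + thetac) l + 'd (psi^~ t) (v t) l.
  by case: dU => dUd dUv; exact: etrans (dot_gradient l dUd) (congr1 (@^~ l) dUv).
have thl := is_derive_within_theta t0t vl.
have fl := is_derive_within_comp (fdiff _) thl.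
have fcl := is_derive_withinD fl (is_derive_within_cst D (- f thetac) t).
have gfl := is_derive_withinZ (gammaD Dt) fcl.
have := is_derive_withinD gfl (is_derive_within_C1_prod psiC1 t0t vl).
rewrite {}dUl /bregman (dot_gradient _ (fdiff _)).
set th := (gamma t)^-1 *: v t + thetac.
have dfv : 'd f th (thetac - th) = - ((gamma t)^-1 * 'd f th (v t)).
  have -> : thetac - th = - ((gamma t)^-1 *: v t).
    by rewrite /th opprD addrCA subrr addr0.
  by rewrite linearN; congr (- _); exact: linearZ.
have dfl : 'd f th (- gamma t ^- 2 * dgamma t *: v t + (gamma t)^-1 *: l) =
    - gamma t ^- 2 * dgamma t * 'd f th (v t) + (gamma t)^-1 * 'd f th l.
  by rewrite linearD; congr (_ + _); exact: linearZ.
congr (is_derive_within _ _ _ _).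
(* The identity is isolated over plain scalars: [k1] and [l1] stand for the differential of [f]
   along [v t] and [l], [S] and [P] for the two contributions of [psi]. *)
have key (dg g F Fc L S P B k1 l1 : R) : g != 0 -> B = - (g^-1 * k1) ->
    L = - g ^- 2 * dg * k1 + g^-1 * l1 ->
    dg * (F - Fc) + g * (L + 0) + (S + P) = l1 + S - dg * (Fc - F - B) + P.
  by move=> g0 -> ->; field.
exact: key gt0 dfv dfl.
Qed.

End Potential.

(** * Dissipation of the storage function and continuity of the integrands *)

Lemma lyapunov_rate (R : realType) (d n : nat) (A P Q : 'M[R]_d) (B : 'M[R]_(d, n))
    (x : 'cV[R]_d) (u : 'cV[R]_n) :
  P^T = P -> A^T *m P + P *m A = - Q ->
  ((A *m x + B *m u)^T *m P *m x) 0 0 + (x^T *m P *m (A *m x + B *m u)) 0 0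
  = - qform Q x + 2 * dot (B^T *m P *m x) u.
Proof.
move=> PT AP.
have BE (N N' : 'M[R]_1) : (N + N') 0 0 = N 0 0 + N' 0 0 by rewrite !mxE.
have TE (N : 'M[R]_1) : N^T 0 0 = N 0 0 by rewrite mxE.
have -> : (A *m x + B *m u)^T = x^T *m A^T + u^T *m B^T.
  by rewrite -!trmx_mul; exact: linearD.
rewrite /qform /dot !mulmxDl mulmxDr !BE.
(* A 1 by 1 matrix equals its transpose, so by symmetry of [P] both input terms coincide, whence the
   factor 2. *)
have -> : (u^T *m B^T *m P *m x) 0 0 = (x^T *m P *m (B *m u)) 0 0.
  by rewrite -TE !trmx_mul !trmxK PT !mulmxA.
have -> : (B^T *m P *m x)^T *m u = x^T *m P *m (B *m u).
  by rewrite !trmx_mul trmxK PT !mulmxA.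
have -> : - (x^T *m Q *m x) 0 0 =
    (x^T *m A^T *m P *m x) 0 0 + (x^T *m P *m (A *m x)) 0 0.
  rewrite -BE -!mulmxA -mulmxDr [A^T *m _]mulmxA [P *m _]mulmxA -mulmxDl AP.
  by rewrite mulNmx mulmxN [in RHS]mxE.
ring.
Qed.

Lemma cvg_bregman (R : realType) (n : nat) (f : 'cV[R]_n -> R)
    (D : set R) (thetac : 'cV[R]_n) (theta : R -> 'cV[R]_n) t :
  (forall z, differentiable f z) -> convex_function setT f ->
  theta @ within D (nbhs t) --> theta t ->
  bregman f thetac (theta s) @[s --> within D (nbhs t)] -->
  bregman f thetac (theta t).
Proof.
move=> fdiff fconv thc.
have fc : continuous f by move=> z; exact: differentiable_continuous.
apply: cvgB.
  by apply: cvgB; [exact: cvg_cst|exact: cvg_comp _ _ thc (fc _)].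
(* Inserting the identity matrix presents the dot product as a bilinear form; gradient entries
   converge by [continuous_convex_diff]. *)
rewrite /dot -(mulmx1 (gradient f (theta t))^T).
under eq_fun do rewrite -(mulmx1 (gradient f _)^T).
apply: cvg_bilinear_form => i.
  rewrite mxE deriveE//; under eq_fun do rewrite mxE deriveE//.
  exact: cvg_comp _ _ thc
    (continuous_convex_diff fdiff fconv (h := delta_mx i 0)).
rewrite 2!mxE; under eq_fun do rewrite 2!mxE.
by apply: cvgB; [exact: cvg_cst|exact: cvg_coord thc].
Qed.

(** The curve [(v s, s)] stays in the set where the time derivative of [psi] is jointly continuous
    as long as [s] is in [D]. *)
Lemma cvg_derive_within (R : realType) (n : nat)
    (psi : 'cV[R]_n -> R -> R) (D : set R) (v : R -> 'cV[R]_n) t :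
  C1_prod_within D psi -> D t -> v @ within D (nbhs t) --> v t ->
  derive_within D (psi (v s)) s @[s --> within D (nbhs t)] -->
  derive_within D (psi (v t)) t.
Proof.
move=> [_ _ _ /subspace_continuousP psic] Dt vc.
have vs : (v s, s) @[s --> within D (nbhs t)] -->
    within [set p : 'cV[R]_n * R | D p.2] (nbhs (v t, t)).
  move=> P [[/= A B] [Av Bt] AB].
  have Avs : \forall s \near within D (nbhs t), A (v s) by exact: vc Av.
  have Bs : \forall s \near within D (nbhs t), B s by exact: cvg_within Bt.
  suff : \forall s \near within D (nbhs t), P (v s, s) by [].
  near=> s; apply: (AB (v s, s)); last by near: s; exact: withinT.
  by split; [near: s; exact: Avs|near: s; exact: Bs].
exact: cvg_comp _ _ vs (psic (v t, t) Dt).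
Unshelve. all: by end_near. Qed.

(** * Energy balance along the flow, its integration and the resulting bounds *)

Theorem mainTheorem1 (R : realType) (n m : nat) (hm : (1 <= m)%N)
    (f : 'cV[R]_n -> R)
    (hfdiff : forall z, differentiable f z)
    (hfconv : convex_function setT f)
    (t0 : R) (thetac : 'cV[R]_n)
    (a : 'I_m -> R) (hA : hurwitz (canonA n a))
    (Q P : 'M[R]_(m * n)) (hQ : sym_posdef Q) (hP : sym_posdef P)
    (hlyap : (canonA n a)^T *m P + P *m canonA n a = - Q)
    (alpha : R -> R)
    (halphaC : {within `[t0, +oo[, continuous alpha})
    (halpha0 : forall t, t0 <= t -> alpha t != 0)
    (gamma : R -> R)
    (hgammaC1 : C1_within `[t0, +oo[ gamma)
    (hgamma_gt0 : forall t, t0 <= t -> 0 < gamma t)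
    (hdgamma_gt0 : forall t, t0 <= t -> 0 < derive_within `[t0, +oo[ gamma t)
    (psi : 'cV[R]_n -> R -> R)
    (hpsiC1 : C1_prod_within `[t0, +oo[ psi)
    (psi_low : R)
    (hpsi_low : forall v t, t0 <= t -> psi_low <= psi v t)
    (hdpsi : forall v t, t0 <= t -> derive_within `[t0, +oo[ (psi v) t <= 0)
    (x : R -> 'cV[R]_(m * n)) (v : R -> 'cV[R]_n) :
  let A := canonA n a in
  let B := canonB R m n in
  let C := B^T *m P in
  let U (w : 'cV[R]_n) (t : R) : R :=
    gamma t * (f ((gamma t)^-1 *: w + thetac) - f thetac) + psi w t in
  let u (t : R) : 'cV[R]_n :=
    - (alpha t *: gradient (fun w => U w t) (v t)) in
  let y (t : R) : 'cV[R]_n := C *m x t in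
  let theta (t : R) : 'cV[R]_n := (gamma t)^-1 *: v t + thetac in
  let V (t : R) : R := 2^-1 * qform P (x t) in
  let E : R := U (v t0) t0 + V t0 in
  (forall t, t0 <= t ->
     is_derive_within `[t0, +oo[ x t (A *m x t + B *m u t)) ->
  (forall t, t0 <= t ->
     is_derive_within `[t0, +oo[ v t (alpha t *: y t)) ->
  (forall t, t0 <= t -> 0 <= f (theta t) - f thetac) ->
  (forall t, t0 <= t -> 0 <= U (v t) t) ->
  forall t, t0 <= t ->
  [/\ E = gamma t * (f (theta t) - f thetac) + psi (v t) t + V t
          + \int[lebesgue_measure]_(tau in `[t0, t])
              (derive_within `[t0, +oo[ gamma tau
               * bregman f thetac (theta tau))
          - \int[lebesgue_measure]_(tau in `[t0, t])
              derive_within `[t0, +oo[ (psi (v tau)) tau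
          + 2^-1 * \int[lebesgue_measure]_(tau in `[t0, t])
              qform Q (x tau),
      f (theta t) - f thetac <= (E - psi_low) / gamma t,
      (E - psi_low) / gamma t =
        (gamma t0 * (f (theta t0) - f thetac) + psi (v t0) t0 - psi_low
         + 2^-1 * qform P (x t0)) / gamma t &
      psi (v t) t <= E].
Proof.
move=> A B C U u y theta V E xl vl fth0 _ t t0t.
set D := (`[t0, +oo[%classic) in hgammaC1 hdgamma_gt0 hpsiC1 hdpsi xl vl *.
have DP s : D s <-> t0 <= s by rewrite /D /= in_itv/= andbT.
have [gammaD /subspace_continuousP dgammac] := hgammaC1.
have thc s : D s -> theta @ within D (nbhs s) --> theta s.
  move=> /DP t0s.
  exact: cvg_is_derive_within
    (is_derive_within_theta thetac gammaD hgamma_gt0 t0s (vl s t0s)).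
have vc s : D s -> v @ within D (nbhs s) --> v s.
  by move=> /DP t0s; exact: cvg_is_derive_within (vl s t0s).
have xc s : D s -> x @ within D (nbhs s) --> x s.
  by move=> /DP t0s; exact: cvg_is_derive_within (xl s t0s).
pose h1 s := derive_within D gamma s * bregman f thetac (theta s).
pose h2 s := derive_within D (psi (v s)) s.
pose h3 s := qform Q (x s).
have h1c : {within D, continuous h1}.
  apply/subspace_continuousP => s Ds; apply: cvgM; first exact: dgammac.
  exact: cvg_bregman hfdiff hfconv (thc s Ds).
have h2c : {within D, continuous h2}.
  by apply/subspace_continuousP => s Ds; exact: cvg_derive_within (vc s Ds).
have h3c : {within D, continuous h3}.
  apply/subspace_continuousP => s Ds; apply: cvg_bilinear_form => i;
  exact: cvg_coord (xc s Ds).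
(* [W] is the total energy, and [h] collects the integrands of (i) with the signs they have in its
   time derivative. *)
pose W s := U (v s) s + V s.
pose h s := h2 s - h1 s - 2^-1 * h3 s.
have Wl s : D s -> is_derive_within D W s (h s).
  move=> /DP t0s.
  have Ul := is_derive_within_potential hfdiff gammaD hgamma_gt0 hpsiC1
    (thetac := thetac) t0s (vl s t0s).
  have Vl := is_derive_withinZ (is_derive_within_cst D (2^-1 : R) s)
    (is_derive_within_qform (M := P) (xl s t0s)).
  have := is_derive_withinD Ul Vl.
  rewrite (lyapunov_rate _ _ _ hP.1 hlyap).
  congr (is_derive_within _ _ _ _).
  (* Cancellation of the exchanged power: with [k = alpha s] and [G] the product of the gradient of
     [U] with the output, the potential gains [k * G] and the storage function loses it. The factor
     0 is the derivative of the constant 1/2. *)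
  have key (k b dp g1 yu q G l : R) : l = k * G -> yu = - (k * G) ->
    l - b + dp + (0 * g1 + 2^-1 * (- q + 2 * yu)) = dp - b - 2^-1 * q.
    by move=> -> ->; field.
  apply: (key (alpha s) _ _ _ _ _ (dot (gradient (U^~ s) (v s)) (y s))).
    by rewrite dotZr.
  by rewrite dotNr dotZr dotC.
have hc : {within D, continuous h}.
  move/subspace_continuousP in h1c; move/subspace_continuousP in h2c.
  move/subspace_continuousP in h3c.
  apply/subspace_continuousP => s Ds; apply: cvgB.
    by apply: cvgB; [exact: h2c|exact: h1c].
  by apply: cvgM; [exact: cvg_cst|exact: h3c].
have int g : {within D, continuous g} ->
    lebesgue_measure.-integrable `[t0, t] (EFin \o g).
  move=> gc; apply: continuous_compact_integrable; first exact: segment_compact.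
  exact: continuous_segment_half_line (lexx _) gc.
have := Rintegral_derive_within t0t Wl hc.
have mD : measurable (`[t0, t]%classic : set R) by [].
have i3 : lebesgue_measure.-integrable `[t0, t] (EFin \o (fun s => 2^-1 * h3 s)).
  apply: int; apply/subspace_continuousP => s Ds.
  by apply: cvgM; [exact: cvg_cst|move/subspace_continuousP in h3c; exact: h3c].
have i21 : lebesgue_measure.-integrable `[t0, t] (EFin \o (fun s => h2 s - h1 s)).
  apply: int; apply/subspace_continuousP => s Ds.
  move/subspace_continuousP in h1c; move/subspace_continuousP in h2c.
  by apply: cvgB; [exact: h2c|exact: h1c].
rewrite RintegralB// RintegralB//; [|exact: int..].
rewrite RintegralZl//; last exact: int.
move=> intW.
have Q0 z : 0 <= qform Q z.
  have [->|z0] := eqVneq z 0; last exact/ltW/hQ.2.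
  by rewrite /qform mulmx0 mxE.
have P0 z : 0 <= qform P z.
  have [->|z0] := eqVneq z 0; last exact/ltW/hP.2.
  by rewrite /qform mulmx0 mxE.
have I1 : 0 <= \int[lebesgue_measure]_(s in `[t0, t]) h1 s.
  apply: Rintegral_ge0 => s; rewrite /= in_itv/= => /andP[t0s _].
  by rewrite mulr_ge0 ?bregman_ge0// ltW// hdgamma_gt0.
have I2 : \int[lebesgue_measure]_(s in `[t0, t]) h2 s <= 0.
  rewrite -oppr_ge0.
  have -> : - (\int[lebesgue_measure]_(s in `[t0, t]) h2 s) =
     \int[lebesgue_measure]_(s in `[t0, t]) (- 1 * h2 s).
    by rewrite RintegralZl ?mulN1r//; exact: int.
  apply: Rintegral_ge0 => s; rewrite /= in_itv/= => /andP[t0s _].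
  by rewrite mulN1r oppr_ge0; exact: hdpsi.
have I3 : 0 <= \int[lebesgue_measure]_(s in `[t0, t]) h3 s.
  by apply: Rintegral_ge0 => s _; exact: Q0.
have E1 : E = gamma t * (f (theta t) - f thetac) + psi (v t) t + V t
   + (\int[lebesgue_measure]_(s in `[t0, t]) h1 s)
   - (\int[lebesgue_measure]_(s in `[t0, t]) h2 s)
   + 2^-1 * (\int[lebesgue_measure]_(s in `[t0, t]) h3 s).
  have -> : E = W t - (W t - W t0) by rewrite subKr.
  by rewrite -intW /W /U -/(theta t); ring.
have gt0 := hgamma_gt0 t t0t.
have Vt : 0 <= V t by rewrite mulr_ge0.
have fg : 0 <= gamma t * (f (theta t) - f thetac) by rewrite mulr_ge0 ?fth0// ltW.
(* One inequality serves both remaining bounds: (ii) replaces [q], the value of [psi], by [psi_low],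
   and (iii) drops [p], which is nonnegative by [fg]. *)
have bound (p q r j1 j2 j3 : R) : 0 <= r -> 0 <= j1 -> j2 <= 0 -> 0 <= j3 ->
    p + q <= p + q + r + j1 - j2 + 2^-1 * j3.
  by clear; lra.
have Eub := bound (gamma t * (f (theta t) - f thetac)) (psi (v t) t)
  _ _ _ _ Vt I1 I2 I3.
rewrite -E1 in Eub.
split.
- exact: E1.
- rewrite ler_pdivlMr// mulrC lerBrDr; apply: le_trans Eub.
  by rewrite lerD2l hpsi_low.
- by congr (_ / _); rewrite /E /U /V -/(theta t0); ring.
- by apply: le_trans Eub; rewrite lerDr.
Qed.
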